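(* Consider the draining problem described in the context. For any optimal trajectory $(s^\ast,R^\ast)$ with optimal control $u^\ast$ and optimal cost $T^\ast$, there exists a unique time $t^0$ such that $\|s^\ast(t^0)-x\|=\delta$ and $R^\ast(t^0)=0$, where $\delta=\sqrt{r^2(B-A)/B}$. Moreover, $$u^\ast(t)=\frac{s^\psi-s^\ast(t^0)}{\|s^\psi-s^\ast(t^0)\|}\quad\text{for every }t\in[t^0,T^\ast].$$
   Context: $\|\cdot\|$ is the Euclidean norm. A single target sits at the fixed position $x\in\mathbb{R}^2$, with sensing range $r>0$ and constants $A,B$ with $B>A$ (uncertainty accumulation rate $A$). The agent has position $s(t)\in\mathbb{R}^2$ with dynamics $\dot s(t)=u(t)$ and control constraint $\|u(t)\|\le 1$. Define $p(s)=\max\{0,\,1-\|s-x\|^2/r^2\}$ and $f_R(R,s)=0$ if $R=0$ and $A-Bp(s)<0$, and $f_R(R,s)=A-Bp(s)$ otherwise. The entrance point $s^\varphi$ and departure point $s^\psi$ are the points where the agent starts, respectively stops, sensing the target, and $\check R$ is the uncertainty at arrival. The draining problem is: minimize $T$ over $T$ and controls $u:[0,T]\to\mathbb{R}^2$ subject to $\dot s=u$, $\dot R=f_R(R,s)$, $\|u(t)\|^2\le1$, $\min_{\tau\in[0,T]}R(\tau)=0$, $s(0)=s^\varphi$, $s(T)=s^\psi$, $R(0)=\check R$.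
   Formalization: The formula for u* is proved for almost every t in [t^0,T*] rather than every t, since altering an optimal control at one instant keeps it optimal; A>0 and positive uncertainty at arrival are made explicit. *)

(* Defs.v *)
From HB Require Import structures.
From mathcomp Require Import all_boot all_order all_algebra.
From mathcomp Require Import all_classical all_reals all_analysis.
Set Implicit Arguments. Unset Strict Implicit. Unset Printing Implicit Defensive.
Import Order.TTheory GRing.Theory Num.Theory.
Local Open Scope classical_set_scope.
Local Open Scope ring_scope.

Section Draining.
Variable R : realType.

Definition dist2 (p q : R * R) : R :=
  Num.sqrt ((p.1 - q.1) ^+ 2 + (p.2 - q.2) ^+ 2).

Definition psense (r : R) (x s : R * R) : R :=
  Num.max 0 (1 - (dist2 s x) ^+ 2 / r ^+ 2).

Definition fR (A B r : R) (x : R * R) (Rv : R) (s : R * R) : R :=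
  if (Rv == 0) && (A - B * psense r x s < 0) then 0
  else A - B * psense r x s.

(* Feasibility for the draining problem (Caratheodory solutions):
   u measurable on [0,T] with ||u(t)||^2 <= 1,
   s(t) = s^phi + int_0^t u,  R(t) = Rc + int_0^t f_R(R, s),
   s(T) = s^psi, and min_{[0,T]} R = 0. *)
Definition feasible (A B r : R) (x sphi spsi : R * R) (Rc T : R)
    (u : R -> R * R) (s : R -> R * R) (Rt : R -> R) : Prop :=
  0 <= T /\
  measurable_fun [set` `[0, T]] (fun t => (u t).1) /\
  measurable_fun [set` `[0, T]] (fun t => (u t).2) /\
  (forall t, t \in `[0, T] -> (u t).1 ^+ 2 + (u t).2 ^+ 2 <= 1) /\
  (forall t, t \in `[0, T] ->
     s t = (sphi.1 + Rintegral lebesgue_measure [set` `[0, t]] (fun tau => (u tau).1),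
            sphi.2 + Rintegral lebesgue_measure [set` `[0, t]] (fun tau => (u tau).2))) /\
  measurable_fun [set` `[0, T]] (fun tau => fR A B r x (Rt tau) (s tau)) /\
  (forall t, t \in `[0, T] ->
     Rt t = Rc + Rintegral lebesgue_measure [set` `[0, t]]
                   (fun tau => fR A B r x (Rt tau) (s tau))) /\
  s 0 = sphi /\ s T = spsi /\ Rt 0 = Rc /\
  (exists tau, tau \in `[0, T] /\ Rt tau = 0) /\
  (forall tau, tau \in `[0, T] -> 0 <= Rt tau).

Definition optimal (A B r : R) (x sphi spsi : R * R) (Rc T : R)
    (u : R -> R * R) (s : R -> R * R) (Rt : R -> R) : Prop :=
  feasible A B r x sphi spsi Rc T u s Rt /\
  forall T' u' s' Rt', feasible A B r x sphi spsi Rc T' u' s' Rt' -> T <= T'.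

End Draining.

(* Main.v *)
Require Import Defs.
From HB Require Import structures.
From mathcomp Require Import all_boot all_order all_algebra.
From mathcomp Require Import all_classical all_reals all_analysis.
From mathcomp Require Import measurable_realfun ring lra.
Import Order.TTheory GRing.Theory Num.Theory.
Import numFieldNormedType.Exports.
Local Open Scope classical_set_scope.
Local Open Scope ring_scope.

(** Once the target is drained, the agent sits in the closed disk of radius
    [delta], where the drift of the uncertainty is nonpositive, so the straight
    unit-speed run to [spsi] keeps the uncertainty at zero until it leaves that
    convex disk. Hence after any drained time an optimal trajectory is that
    straight run; its exit from the disk gives [t0] and the control.
    If two such times existed, the trajectory would reach the disk at [t0] with
    the draining just completed and then follow a chord. Leaving it slightly
    earlier, from inside the disk, straight towards the middle of the chord,
    drains the little uncertainty that remains and is not slower only if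
    [ss t0] lies on a segment interior to the disk, whereas it is on the
    boundary. *)

Set Implicit Arguments. Unset Strict Implicit. Unset Printing Implicit Defensive.

(** * Integrals over compact intervals and Lipschitz primitives *)

Section IntervalIntegrals.
Context {R : realType}.
Notation mu := (@lebesgue_measure R).
Implicit Types (f g h F : R -> R) (a b c t T M k : R).

Definition itv_int a b f := Rintegral mu [set` `[a, b]] f.

Lemma itv_int_eq a b f g : (forall t, a <= t <= b -> f t = g t) ->
  itv_int a b f = itv_int a b g.
Proof.
by move=> fg; apply: eq_Rintegral => t; rewrite inE/= in_itv/=; exact: fg.
Qed.

Lemma bounded_itv_integrable a b f M : measurable_fun [set` `[a, b]] f ->
  (forall t, a <= t <= b -> `|f t| <= M) ->
  mu.-integrable [set` `[a, b]] (EFin \o f).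
Proof.
move=> mf bf; apply: measurable_bounded_integrable => //.
  by rewrite /= lebesgue_measure_itv/=; case: ifPn => _ //; rewrite -EFinD ltry.
exists M; split; first exact: num_real.
by move=> x Mx t /=; rewrite in_itv/= => /bf h; exact: le_trans h (ltW Mx).
Qed.

Lemma itv_integrableS a b a' b' f : a <= a' -> b' <= b ->
  mu.-integrable [set` `[a, b]] (EFin \o f) ->
  mu.-integrable [set` `[a', b']] (EFin \o f).
Proof.
move=> aa bb; apply: integrableS => //.
by apply: subset_itvScc; rewrite bnd_simp.
Qed.

Lemma itv_int_xx a f : itv_int a a f = 0.
Proof. by rewrite /itv_int set_itv1 Rintegral_set1. Qed.

Lemma itv_int_split a b c f : a <= c -> c <= b ->
  mu.-integrable [set` `[a, b]] (EFin \o f) ->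
  itv_int a b f = itv_int a c f + itv_int c b f.
Proof.
move=> ac cb fi; apply/eqP; rewrite addrC -subr_eq; apply/eqP.
rewrite /itv_int Rintegral_itvB//; try by rewrite bnd_simp.
by rewrite Rintegral_itv_obnd_cbnd //; apply: integrableS fi => //;
  apply: subset_itvr; rewrite bnd_simp.
Qed.

Lemma itv_int_cst a b k : a <= b -> itv_int a b (cst k) = k * (b - a).
Proof.
move=> ab; rewrite /itv_int Rintegral_cst//= lebesgue_measure_itv/= lte_fin.
case: ltP => // ba.
have -> : b = a by apply/eqP; rewrite eq_le ab ba.
by rewrite subrr.
Qed.

Lemma itv_int_le_cst a b f k : a <= b ->
  mu.-integrable [set` `[a, b]] (EFin \o f) ->
  (forall t, a <= t <= b -> f t <= k) -> itv_int a b f <= k * (b - a).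
Proof.
move=> ab fi fk; rewrite -itv_int_cst//; apply: le_Rintegral => //.
by apply: (@bounded_itv_integrable _ _ _ `|k|).
Qed.

Lemma itv_int_ge_cst a b f k : a <= b ->
  mu.-integrable [set` `[a, b]] (EFin \o f) ->
  (forall t, a <= t <= b -> k <= f t) -> k * (b - a) <= itv_int a b f.
Proof.
move=> ab fi fk; rewrite -itv_int_cst//; apply: le_Rintegral => //.
by apply: (@bounded_itv_integrable _ _ _ `|k|).
Qed.

Lemma eq_itv_int_oo a b f g : measurable_fun [set` `[a, b]] f ->
  measurable_fun [set` `[a, b]] g -> (forall t, a < t < b -> f t = g t) ->
  itv_int a b f = itv_int a b g.
Proof.
move=> mf mg fg; rewrite /itv_int /Rintegral; congr fine.
apply: eq_integral_itv_bounded.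
- by apply: measurable_funS mf => //; exact: subset_itv_oo_cc.
- by apply: measurable_funS mg => //; exact: subset_itv_oo_cc.
- by move=> t; rewrite in_itv; exact: fg.
Qed.

(** The value at [a] itself comes from [g]; [switch_le] covers pieces that agree there. *)
Definition switch (U : Type) a (f g : R -> U) := fun t => if t < a then f t else g t.

Lemma switch_lt (U : Type) a (f g : R -> U) t : t < a -> switch a f g t = f t.
Proof. by rewrite /switch => ->. Qed.

Lemma switch_ge (U : Type) a (f g : R -> U) t : a <= t -> switch a f g t = g t.
Proof. by rewrite /switch leNgt => /negbTE ->. Qed.

Lemma switch_le (U : Type) a (f g : R -> U) t : f a = g a -> t <= a ->
  switch a f g t = f t.
Proof. by rewrite /switch => fg; case: ltgtP => // ->. Qed.

Lemma switch_measurable b T a f g :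
  measurable_fun [set` `[b, a]] f -> measurable_fun [set` `[a, T]] g ->
  measurable_fun [set` `[b, T]] (switch a f g).
Proof.
move=> mf mg; apply: measurable_fun_if => //.
- exact: measurable_fun_ltr.
- apply: measurable_funS mf => // t /=; rewrite !in_itv/=.
  by move=> [/andP[-> _] /ltW ->].
- apply: measurable_funS mg => // t /=; rewrite !in_itv/=.
  by move=> [/andP[_ ->]]; rewrite ltNge => /negbFE ->.
Qed.

(** The Caratheodory form of F' = f with |f| <= M: the bound makes [f] integrable and [F] Lipschitz,
    and no pointwise derivative is required. *)
Definition primitive T M f F :=
  [/\ measurable_fun [set` `[0, T]] f,
      (forall t, 0 <= t <= T -> `|f t| <= M) &
      forall t, 0 <= t <= T -> F t = F 0 + itv_int 0 t f].

Lemma primitive_sub T T' M f F : T' <= T -> primitive T M f F -> primitive T' M f F.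
Proof.
move=> TT [mf bf eF]; split.
- by apply: measurable_funS mf => //; apply: subset_itvScc; rewrite bnd_simp.
- by move=> t /andP[t0 tT]; rewrite bf ?t0 ?(le_trans tT).
- by move=> t /andP[t0 tT]; rewrite eF ?t0 ?(le_trans tT).
Qed.

Lemma eq_primitive T M f f' F F' : 0 <= T ->
  (forall t, 0 <= t <= T -> f t = f' t) ->
  (forall t, 0 <= t <= T -> F t = F' t) ->
  primitive T M f F -> primitive T M f' F'.
Proof.
move=> T0 ef eF [mf bf IF]; split.
- by apply: eq_measurable_fun mf => t; rewrite inE/= in_itv; exact: ef.
- by move=> t tT; rewrite -ef// bf.
- move=> t /andP[t0 tT]; rewrite -!eF ?lexx ?t0// IF ?t0//.
  congr (_ + _); apply: itv_int_eq => w /andP[w0 wt].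
  by rewrite ef// w0 (le_trans wt).
Qed.

Lemma primitive_integrable T M f F a b : primitive T M f F ->
  0 <= a -> b <= T -> mu.-integrable [set` `[a, b]] (EFin \o f).
Proof.
move=> [mf bf _] a0 bT; apply: itv_integrableS a0 bT _.
exact: bounded_itv_integrable mf bf.
Qed.

Lemma primitive_incr T M f F a b : primitive T M f F ->
  0 <= a -> a <= b -> b <= T -> F b - F a = itv_int a b f.
Proof.
move=> pF a0 ab bT; have fi := primitive_integrable pF (lexx 0) bT.
case: pF => _ _ eF; rewrite eF ?bT ?(le_trans a0)// (eF a) ?a0 ?(le_trans ab)//.
by rewrite (itv_int_split a0 ab fi); ring.
Qed.

Lemma primitive_le T M f F a b k : primitive T M f F ->
  0 <= a -> a <= b -> b <= T -> (forall t, a <= t <= b -> f t <= k) ->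
  F b - F a <= k * (b - a).
Proof.
move=> pF a0 ab bT fk; rewrite (primitive_incr pF)//.
by apply: itv_int_le_cst => //; exact: primitive_integrable pF _ _.
Qed.

Lemma primitive_ge T M f F a b k : primitive T M f F ->
  0 <= a -> a <= b -> b <= T -> (forall t, a <= t <= b -> k <= f t) ->
  k * (b - a) <= F b - F a.
Proof.
move=> pF a0 ab bT fk; rewrite (primitive_incr pF)//.
by apply: itv_int_ge_cst => //; exact: primitive_integrable pF _ _.
Qed.

(** For [t <= a] the integrand differs from [f] at most at [a], a null set; beyond [a] the integral
    splits there. *)
Lemma switch_primitive a T M f F g : 0 <= a -> primitive a M f F ->
  measurable_fun [set` `[a, T]] g -> (forall t, a <= t <= T -> `|g t| <= M) ->
  primitive T M (switch a f g) (switch a F (fun t => F a + itv_int a t g)).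
Proof.
move=> a0 [mf bf eF] mg bg.
have mfg := switch_measurable mf mg.
have bfg t : 0 <= t <= T -> `|switch a f g t| <= M.
  move=> /andP[t0 tT]; rewrite /switch; case: ltP => ta.
    by apply: bf; rewrite t0 ltW.
  by apply: bg; rewrite ta.
have iF t : 0 <= t -> t <= a -> t <= T ->
    itv_int 0 t (switch a f g) = itv_int 0 t f.
  move=> t0 ta tT; apply: eq_itv_int_oo.
  - by apply: measurable_funS mfg => //; apply: subset_itvScc; rewrite bnd_simp.
  - by apply: measurable_funS mf => //; apply: subset_itvScc; rewrite bnd_simp.
  - by move=> s /andP[_ st]; rewrite switch_lt// (lt_le_trans st).
split => // t /andP[t0 tT]; rewrite [in LHS]/switch.
(* If [a = 0], the second branch is taken at 0, and its integral over a single point vanishes. *)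
have -> : switch a F (fun t => F a + itv_int a t g) 0 = F 0.
  rewrite /switch; case: ltP => // a0'.
  have -> : a = 0 by apply/eqP; rewrite eq_le a0'.
  by rewrite itv_int_xx addr0.
case: ltP => ta; first by rewrite iF ?(ltW ta)// eF// t0 ltW.
rewrite (itv_int_split a0 ta); last first.
  by apply: itv_integrableS (bounded_itv_integrable mfg bfg).
rewrite (iF a a0 (lexx a) (le_trans ta tT)) addrA -eF ?a0 ?lexx//; congr (_ + _).
by apply: itv_int_eq => s /andP[as_ _]; rewrite /switch ltNge as_.
Qed.

(** Serves to project velocity and position onto a fixed direction. *)
Lemma primitive_lin T M f F g G (p q : R) :
  primitive T M f F -> primitive T M g G ->
  primitive T ((`|p| + `|q|) * M) (fun t => p * f t + q * g t)
    (fun t => p * F t + q * G t).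
Proof.
move=> pF pG; have [mf bf eF] := pF; have [mg bg eG] := pG; split.
- by apply: measurable_funD; apply: measurable_funM.
- move=> t tT; rewrite (le_trans (ler_normD _ _))// !normrM mulrDl lerD//.
    by rewrite ler_wpM2l// bf.
  by rewrite ler_wpM2l// bg.
- move=> t /andP[t0 tT].
  have fi := primitive_integrable pF (lexx 0) tT.
  have gi := primitive_integrable pG (lexx 0) tT.
  rewrite eF ?t0// eG ?t0// /itv_int RintegralD//.
  + by rewrite !RintegralZl//; ring.
  + exact: integrableZl fi.
  + exact: integrableZl gi.
Qed.

(** [k - f] is nonnegative with zero integral, so it vanishes almost everywhere. *)
Lemma primitive_ae_max T M f F a b k : primitive T M f F ->
  0 <= a -> a <= b -> b <= T -> (forall t, a <= t <= b -> f t <= k) ->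
  F b - F a = k * (b - a) -> {ae mu, forall t, t \in `[a, b] -> f t = k}.
Proof.
move=> pF a0 ab bT fk; rewrite (primitive_incr pF)// => eI.
have fi := primitive_integrable pF a0 bT.
have ki : mu.-integrable [set` `[a, b]] (EFin \o cst k).
  by apply: (@bounded_itv_integrable _ _ _ `|k|).
have di : mu.-integrable [set` `[a, b]] (EFin \o (fun t => k - f t)).
  exact: integrableB ki fi.
have I0 : (\int[mu]_(t in [set` `[a, b]]) (k - f t)%:E = 0)%E.
  rewrite -[LHS]fineK; last exact: integrable_fin_num di.
  congr EFin; transitivity (itv_int a b (cst k) - itv_int a b f).
    exact: RintegralB.
  by rewrite eI itv_int_cst// subrr.
have /(ae_eq_integral_abs mu) [//|+ _] :
    measurable_fun [set` `[a, b]] (EFin \o (fun t => k - f t)).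
  by case/integrableP : di.
move=> ae0; have {ae0} : ae_eq mu [set` `[a, b]] (EFin \o (fun t => k - f t)) (cst 0%E).
  apply: ae0.
  rewrite -[RHS]I0; apply: eq_integral => t; rewrite inE/= in_itv/= => tab.
  by rewrite ger0_norm// subr_ge0 fk.
apply: filterS => t + tab => /(_ tab) [] /eqP.
by rewrite subr_eq0 => /eqP.
Qed.

End IntervalIntegrals.

(** * Squared distances, the triangle inequality and convexity of disks *)

Section PlaneGeometry.
Context {R : realType}.
Implicit Types (p q w e : R * R) (a b k t : R).

Definition sqd p q := (p.1 - q.1) ^+ 2 + (p.2 - q.2) ^+ 2.

Definition line p e t : R * R := (p.1 + t * e.1, p.2 + t * e.2).

Definition direction p q : R * R :=
  ((q.1 - p.1) / dist2 q p, (q.2 - p.2) / dist2 q p).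

Lemma sqd_ge0 p q : 0 <= sqd p q.
Proof. by rewrite addr_ge0// sqr_ge0. Qed.

Lemma sqdC p q : sqd p q = sqd q p.
Proof. by rewrite /sqd; ring. Qed.

Lemma dist2_ge0 p q : 0 <= dist2 p q.
Proof. exact: sqrtr_ge0. Qed.

Lemma dist2_sqr p q : dist2 p q ^+ 2 = sqd p q.
Proof. by rewrite sqr_sqrtr// sqd_ge0. Qed.

(** Cauchy-Schwarz: by Lagrange's identity the defect is the square of the determinant
    [p1 * q2 - p2 * q1]. *)
Lemma dot_le (p1 p2 q1 q2 : R) a b : 0 <= a -> 0 <= b ->
  p1 ^+ 2 + p2 ^+ 2 <= a ^+ 2 -> q1 ^+ 2 + q2 ^+ 2 <= b ^+ 2 ->
  p1 * q1 + p2 * q2 <= a * b.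
Proof.
move=> a0 b0 pa qb; apply: (le_trans (ler_norm _)).
rewrite -ler_sqr ?nnegrE ?normr_ge0 ?mulr_ge0//.
rewrite real_normK ?num_real// exprMn.
apply: le_trans (ler_pM _ _ pa qb); rewrite ?addr_ge0 ?sqr_ge0//.
rewrite -subr_ge0 (_ : _ - _ = (p1 * q2 - p2 * q1) ^+ 2) ?sqr_ge0//.
by ring.
Qed.

Lemma sqd_triangle p q w a b : 0 <= a -> 0 <= b ->
  sqd q p <= a ^+ 2 -> sqd w q <= b ^+ 2 -> sqd w p <= (a + b) ^+ 2.
Proof.
move=> a0 b0 pa qb; have := dot_le a0 b0 pa qb.
by move: pa qb; rewrite /sqd; nra.
Qed.

(** Equality case of the triangle inequality: Cauchy-Schwarz is then tight, so the vector b(q - p) -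
    a(w - q) has norm zero. *)
Lemma sqd_triangle_eq p q w a b : 0 <= a -> 0 <= b ->
  sqd q p <= a ^+ 2 -> sqd w q <= b ^+ 2 -> (a + b) ^+ 2 <= sqd w p ->
  (a + b) * q.1 = b * p.1 + a * w.1 /\ (a + b) * q.2 = b * p.2 + a * w.2.
Proof.
move=> a0 b0 pa qb wp.
have dot : a * b <= (q.1 - p.1) * (w.1 - q.1) + (q.2 - p.2) * (w.2 - q.2).
  by move: pa qb wp; rewrite /sqd; nra.
have : (b * (q.1 - p.1) - a * (w.1 - q.1)) ^+ 2 +
       (b * (q.2 - p.2) - a * (w.2 - q.2)) ^+ 2 <= 0.
  have h1 : 0 <= b ^+ 2 * (a ^+ 2 - sqd q p) by rewrite mulr_ge0 ?sqr_ge0// subr_ge0.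
  have h2 : 0 <= a ^+ 2 * (b ^+ 2 - sqd w q) by rewrite mulr_ge0 ?sqr_ge0// subr_ge0.
  have h3 := ler_wpM2l (mulr_ge0 a0 b0) dot.
  by move: h1 h2 h3; rewrite /sqd; nra.
rewrite le_eqVlt ltNge addr_ge0 ?sqr_ge0// orbF paddr_eq0 ?sqr_ge0// !sqrf_eq0.
by move=> /andP[/eqP h1 /eqP h2]; split; [move: h1|move: h2]; lra.
Qed.

(** Stewart's identity; its last term measures the strict convexity of the squared distance. *)
Lemma sqd_convex p q x k :
  sqd ((1 - k) * p.1 + k * q.1, (1 - k) * p.2 + k * q.2) x =
  (1 - k) * sqd p x + k * sqd q x - k * (1 - k) * sqd p q.
Proof. by rewrite /sqd/=; ring. Qed.

Lemma line_sqd p e s t : e.1 ^+ 2 + e.2 ^+ 2 = 1 ->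
  sqd (line p e s) (line p e t) = (s - t) ^+ 2.
Proof.
move=> e1; rewrite -[RHS]mulr1 -e1 /sqd/line/=; ring.
Qed.

Lemma sqd_line p e t : e.1 ^+ 2 + e.2 ^+ 2 = 1 -> sqd (line p e t) p = t ^+ 2.
Proof. by move=> e1; rewrite -[RHS]mulr1 -e1 /sqd/line/=; ring. Qed.

(** [q] divides the segment from [p] to [w] in the ratio a : b, and an open disk is convex. *)
Lemma sqd_between_lt p q w x a b k : 0 < a -> 0 < b ->
  (a + b) * q.1 = b * p.1 + a * w.1 -> (a + b) * q.2 = b * p.2 + a * w.2 ->
  sqd p x < k -> sqd w x < k -> sqd q x < k.
Proof.
move=> a0 b0 q1 q2 pk wk.
have ab0 : 0 < a + b by rewrite addr_gt0.
have abn : a + b != 0 by rewrite gt_eqF.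
pose c := a / (a + b).
have c0 : 0 < c by rewrite divr_gt0.
have c1 : c < 1 by rewrite ltr_pdivrMr// mul1r ltrDl.
have -> : q = ((1 - c) * p.1 + c * w.1, (1 - c) * p.2 + c * w.2).
  rewrite [LHS]surjective_pairing; congr pair; apply: (mulfI abn).
    by rewrite q1 /c; field.
  by rewrite q2 /c; field.
rewrite sqd_convex; move: c c0 c1 => c c0 c1.
have h1 : 0 < (1 - c) * (k - sqd p x) by rewrite mulr_gt0 ?subr_gt0.
have h2 : 0 < c * (k - sqd w x) by rewrite mulr_gt0 ?subr_gt0.
have h3 : 0 <= c * (1 - c) * sqd p w.
  by apply: mulr_ge0 (sqd_ge0 _ _); rewrite mulr_ge0 ?subr_ge0// ltW.
by lra.
Qed.

Lemma direction_unit p q : 0 < dist2 q p ->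
  (direction p q).1 ^+ 2 + (direction p q).2 ^+ 2 = 1.
Proof.
move=> d0; rewrite /= !expr_div_n -mulrDl -/(sqd q p) dist2_sqr divff//.
by rewrite -dist2_sqr expf_neq0// gt_eqF.
Qed.

Lemma line_direction p q : 0 < dist2 q p -> line p (direction p q) (dist2 q p) = q.
Proof.
move=> d0; have dn : dist2 q p != 0 by rewrite gt_eqF.
by case: q d0 dn => q1 q2 d0 dn; rewrite /line/=; congr pair; field.
Qed.

Lemma line_convex p e b t : b != 0 ->
  line p e t = ((1 - t / b) * p.1 + t / b * (line p e b).1,
                (1 - t / b) * p.2 + t / b * (line p e b).2).
Proof. by move=> b0; rewrite /line/=; congr pair; field. Qed.

(** A closed disk is convex; [t / b] is the weight of the far end. *)
Lemma sqd_line_le p e x b t k : 0 <= t <= b ->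
  sqd p x <= k -> sqd (line p e b) x <= k -> sqd (line p e t) x <= k.
Proof.
move=> /andP[t0 tb] pk bk; have [b0|b0] := eqVneq b 0.
  by have -> : t = b by lra.
have bp : 0 < b by rewrite lt_def b0 (le_trans t0).
have k0 : 0 <= t / b by rewrite divr_ge0// ltW.
have k1 : t / b <= 1 by rewrite ler_pdivrMr// mul1r.
rewrite (line_convex _ _ _ b0) sqd_convex.
move: (t / b) k0 k1 => c k0 k1.
have h1 : 0 <= (1 - c) * (k - sqd p x) by rewrite mulr_ge0 ?subr_ge0.
have h2 : 0 <= c * (k - sqd (line p e b) x) by rewrite mulr_ge0 ?subr_ge0.
have h3 : 0 <= c * (1 - c) * sqd p (line p e b).
  by apply: mulr_ge0 (sqd_ge0 _ _); rewrite mulr_ge0 ?subr_ge0.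
by lra.
Qed.

(** Strict convexity of the disk: unit speed and [0 < b] make the two ends distinct, so the last
    term of [sqd_convex] is strict. *)
Lemma sqd_line_lt p e x b t k : e.1 ^+ 2 + e.2 ^+ 2 = 1 -> 0 < t < b ->
  sqd p x <= k -> sqd (line p e b) x <= k -> sqd (line p e t) x < k.
Proof.
move=> e1 /andP[t0 tb] pk bk; have bp := lt_trans t0 tb.
have b0 : b != 0 by rewrite gt_eqF.
have k0 : 0 < t / b by rewrite divr_gt0.
have k1 : t / b < 1 by rewrite ltr_pdivrMr// mul1r.
have pl : 0 < sqd p (line p e b).
  by rewrite sqdC sqd_line// exprn_gt0.
rewrite (line_convex _ _ _ b0) sqd_convex.
move: (t / b) k0 k1 => c k0 k1.
have h1 : 0 <= (1 - c) * (k - sqd p x) by rewrite mulr_ge0 ?subr_ge0// ltW.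
have h2 : 0 <= c * (k - sqd (line p e b) x).
  by rewrite mulr_ge0 ?subr_ge0// ltW.
have h3 : 0 < c * (1 - c) * sqd p (line p e b).
  by apply: mulr_gt0 pl; rewrite mulr_gt0 ?subr_gt0.
by lra.
Qed.

Lemma continuous_sqd_line p e x (a : R) :
  continuous (fun t => sqd (line p e (t - a)) x).
Proof.
have cl (u v : R) : continuous (fun t => u + (t - a) * v).
  move=> t; apply: cvgD; first exact: cvg_cst.
  apply: cvgM; last exact: cvg_cst.
  by apply: cvgB; [exact: cvg_id|exact: cvg_cst].
have cs (u v w : R) : continuous (fun t => (u + (t - a) * v - w) ^+ 2).
  have cd : continuous (fun t => u + (t - a) * v - w).
    by move=> t; apply: cvgB; [exact: cl|exact: cvg_cst].
  by move=> t; apply: cvgM; exact: cd.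
by move=> t; apply: cvgD; exact: cs.
Qed.

Lemma dist2_gt0_of_sqd (p q y : R * R) : sqd p y < sqd q y -> 0 < dist2 q p.
Proof.
move=> pq; rewrite lt_def dist2_ge0 andbT; apply/eqP => d0.
have := dist2_sqr q p; rewrite d0 expr0n/= => /esym/eqP.
rewrite paddr_eq0 ?sqr_ge0// !sqrf_eq0 !subr_eq0 => /andP[/eqP e1 /eqP e2].
by move: pq; rewrite /sqd e1 e2 ltxx.
Qed.

Lemma norm_le1_of_sqr (a b : R) : a ^+ 2 + b ^+ 2 <= 1 -> `|a| <= 1 /\ `|b| <= 1.
Proof.
move=> ab; have h (c : R) : c ^+ 2 <= 1 -> `|c| <= 1.
  by move=> c1; rewrite -(expr_le1 (n := 2))// real_normK ?num_real.
by split; apply: h; apply: le_trans ab; rewrite ?lerDl ?lerDr sqr_ge0.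
Qed.

End PlaneGeometry.

(** * The drift as a function of the squared distance *)

Section Rate.
Context {R : realType} (A B r : R).
Hypotheses (hr : 0 < r) (hA : 0 < A) (hAB : A < B).
Implicit Types (q k : R).

(** The unclamped drift, with [q] in the role of the squared distance to the target. *)
Definition rate q := A - B * Num.max 0 (1 - q / r ^+ 2).

(** The square of delta: the value of [q] at which [rate] changes sign. *)
Definition equilibrium := r ^+ 2 * (B - A) / B.

Lemma fRE x Rv s : fR A B r x Rv s =
  if (Rv == 0) && (rate (sqd s x) < 0) then 0 else rate (sqd s x).
Proof. by rewrite /fR /psense dist2_sqr. Qed.

Let B0 : 0 < B. Proof. exact: lt_trans hA hAB. Qed.
Let r20 : 0 < r ^+ 2. Proof. by rewrite exprn_gt0. Qed.

Lemma equilibrium_gt0 : 0 < equilibrium.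
Proof. by rewrite divr_gt0// mulr_gt0// subr_gt0. Qed.

Lemma equilibrium_lt : equilibrium < r ^+ 2.
Proof. by rewrite ltr_pdivrMr ?ltr_pM2l ?gtrBl. Qed.

Lemma rate_inside q : q <= r ^+ 2 -> rate q = B / r ^+ 2 * (q - equilibrium).
Proof.
move=> qr; rewrite /rate max_r; last by rewrite subr_ge0 ler_pdivrMr// mul1r.
by rewrite /equilibrium; field; rewrite !gt_eqF.
Qed.

Lemma rate_outside q : r ^+ 2 <= q -> rate q = A.
Proof.
move=> qr; rewrite /rate max_l ?mulr0 ?subr0//.
by rewrite subr_le0 ler_pdivlMr// mul1r.
Qed.

Lemma rate_lt0 q : (rate q < 0) = (q < equilibrium).
Proof.
have [qr|/ltW qr] := leP q (r ^+ 2).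
  by rewrite rate_inside// pmulr_rlt0 ?divr_gt0// subr_lt0.
rewrite rate_outside//; apply/idP/idP; first by rewrite ltNge ltW.
by move=> qe; have := lt_trans (le_lt_trans qr qe) equilibrium_lt; rewrite ltxx.
Qed.

Lemma rate_gt0 q : (0 < rate q) = (equilibrium < q).
Proof.
have [qr|/ltW qr] := leP q (r ^+ 2).
  by rewrite rate_inside// pmulr_rgt0 ?divr_gt0// subr_gt0.
by rewrite rate_outside// hA; apply/esym/(lt_le_trans equilibrium_lt).
Qed.

Lemma le_rate q k : q <= k -> rate q <= rate k.
Proof.
move=> qk; rewrite lerD2l lerN2 ler_pM2l// ge_max le_max lexx/=.
rewrite le_max; apply/orP; right.
by rewrite lerD2l lerN2 ler_pM2r// invr_gt0.
Qed.

Lemma rate_bound q : 0 <= q -> `|rate q| <= A + B.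
Proof.
move=> q0; have : 0 <= Num.max 0 (1 - q / r ^+ 2) <= 1.
  rewrite le_max lexx/= ge_max ler01 lerBlDr lerDl divr_ge0//.
  exact: ltW.
by rewrite /rate ler_norml => /andP[m0 m1]; move: B0 hA => b0 a0; apply/andP; split; nra.
Qed.

Lemma fR_bound x Rv s : `|fR A B r x Rv s| <= A + B.
Proof.
rewrite fRE; case: ifP => _; last by rewrite rate_bound// sqd_ge0.
by rewrite normr0 addr_ge0// ltW.
Qed.

Lemma continuous_rate_line p e x (a : R) :
  continuous (fun t => rate (sqd (line p e (t - a)) x)).
Proof.
move=> t; rewrite /rate; apply: cvgB; first exact: cvg_cst.
apply: cvgM; first exact: cvg_cst.
apply: (@continuous_max _ _ (fun=> 0)
  (fun t => 1 - sqd (line p e (t - a)) x / r ^+ 2)); first exact: cvg_cst.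
apply: cvgB; first exact: cvg_cst.
apply: cvgM; last exact: cvg_cst.
exact: continuous_sqd_line.
Qed.

End Rate.

(** * Trajectories without terminal constraints *)

Section Trajectories.
Context {R : realType} (x : R * R) (r A B Rc : R) (sphi : R * R).
Hypotheses (hr : 0 < r) (hA : 0 < A) (hAB : A < B) (hRc : 0 < Rc).
Notation mu := (@lebesgue_measure R).
Notation fR := (fR A B r x).
Notation rate := (rate A B r).
Notation eqr := (equilibrium A B r).
Implicit Types (a b t T : R) (u s : R -> R * R) (Rt h : R -> R).

(** Feasibility without the terminal position and the draining requirement, so that a trajectory can
    be cut short and continued differently. *)
Record trajectory T u s Rt : Prop := Trajectory {
  trajectory_ge0 : 0 <= T;
  trajectory_fst : primitive T 1 (fun t => (u t).1) (fun t => (s t).1);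
  trajectory_snd : primitive T 1 (fun t => (u t).2) (fun t => (s t).2);
  trajectory_speed : forall t, 0 <= t <= T -> (u t).1 ^+ 2 + (u t).2 ^+ 2 <= 1;
  trajectory_R : primitive T (A + B) (fun t => fR (Rt t) (s t)) Rt;
  trajectory_s0 : s 0 = sphi;
  trajectory_R0 : Rt 0 = Rc;
  trajectory_R_ge0 : forall t, 0 <= t <= T -> 0 <= Rt t }.

Lemma feasibleP spsi T u s Rt :
  feasible A B r x sphi spsi Rc T u s Rt <->
  [/\ trajectory T u s Rt, s T = spsi &
      exists2 tau, 0 <= tau <= T & Rt tau = 0].
Proof.
split.
  move=> [T0 [m1 [m2 [u1 [es [mR [eR [s0 [sT [R0 [[tau [tauT Rtau]] Rge]]]]]]]]]]].
  split => //; last by exists tau => //; move: tauT; rewrite in_itv.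
  have ub t : 0 <= t <= T -> `|(u t).1| <= 1 /\ `|(u t).2| <= 1.
    by move=> tT; apply: norm_le1_of_sqr; apply: u1; rewrite in_itv.
  split => //.
  - split => // t tT; first by have [] := ub _ tT.
    by rewrite es ?in_itv// s0.
  - split => // t tT; first by have [] := ub _ tT.
    by rewrite es ?in_itv// s0.
  - by split => // t tT; [exact: fR_bound|rewrite eR ?in_itv// R0].
move=> [[T0 [m1 b1 e1] [m2 b2 e2] u1 [mR bR eR] s0 R0 Rge] sT [tau tauT Rtau]].
do ![split => //].
- move=> t; rewrite in_itv/= => tT.
  by rewrite [LHS]surjective_pairing e1// e2// s0.
- by move=> t; rewrite in_itv/= => tT; rewrite eR// R0.
- by exists tau; rewrite in_itv.
Qed.

Lemma trajectory_sub T T' u s Rt : 0 <= T' -> T' <= T ->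
  trajectory T u s Rt -> trajectory T' u s Rt.
Proof.
move=> T'0 T'T [T0 p1 p2 u1 pR s0 R0 Rge].
have h t : 0 <= t <= T' -> 0 <= t <= T.
  by move=> /andP[-> tT]; exact: le_trans tT T'T.
by split => //; [exact: primitive_sub p1|exact: primitive_sub p2|
  move=> t /h/u1|exact: primitive_sub pR|move=> t /h/Rge].
Qed.

(** Projecting the velocity onto the displacement, of length [N], gives [N ^+ 2 <= N * (b - a)]. *)
Lemma trajectory_speed_limit T u s Rt a b : trajectory T u s Rt ->
  0 <= a -> a <= b -> b <= T -> sqd (s b) (s a) <= (b - a) ^+ 2.
Proof.
move=> tr a0 ab bT; rewrite -dist2_sqr.
have N0 := dist2_ge0 (s b) (s a); set N := dist2 _ _ in N0 *.
have ba0 : 0 <= b - a by rewrite subr_ge0.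
have pl := primitive_lin ((s b).1 - (s a).1) ((s b).2 - (s a).2)
  (trajectory_fst tr) (trajectory_snd tr).
have := primitive_le pl a0 ab bT (k := N).
have uN t : a <= t <= b ->
  ((s b).1 - (s a).1) * (u t).1 + ((s b).2 - (s a).2) * (u t).2 <= N.
  move=> /andP[at_ tb]; rewrite -[leRHS]mulr1; apply: dot_le => //.
    by rewrite dist2_sqr.
  by rewrite expr1n (trajectory_speed tr)// (le_trans a0)//= (le_trans tb).
move=> /(_ uN).
rewrite (_ : _ - _ = N ^+ 2); last by rewrite dist2_sqr /sqd; ring.
have [->|Nn0] := eqVneq N 0; first by rewrite expr0n/= sqr_ge0.
rewrite expr2 ler_pM2l ?lt_def ?Nn0// => Nb.
by rewrite ler_sqr.
Qed.

(** Appends a straight unit-speed run. As [fR] depends on the uncertainty itself, the drift [h] is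
    given beforehand and checked against its own integral. *)
Lemma trajectory_extend a b u s Rt (e : R * R) h : trajectory a u s Rt -> a <= b ->
  e.1 ^+ 2 + e.2 ^+ 2 = 1 -> measurable_fun [set` `[a, b]] h ->
  (forall t, a <= t <= b ->
    h t = fR (Rt a + itv_int a t h) (line (s a) e (t - a))) ->
  (forall t, a <= t <= b -> 0 <= Rt a + itv_int a t h) ->
  trajectory b (switch a u (cst e)) (switch a s (fun t => line (s a) e (t - a)))
    (switch a Rt (fun t => Rt a + itv_int a t h)).
Proof.
move=> tr ab e1 mh hE R_ge0; have a0 := trajectory_ge0 tr.
have b0 := le_trans a0 ab.
have [e1b e2b] : `|e.1| <= 1 /\ `|e.2| <= 1 by apply: norm_le1_of_sqr; rewrite e1.
have s_join : s a = line (s a) e (a - a).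
  by rewrite /line subrr !mul0r !addr0; case: (s a).
have R_join : Rt a = Rt a + itv_int a a h by rewrite itv_int_xx addr0.
have cst_int (c : R) t : a <= t -> itv_int a t (cst c) = (t - a) * c.
  by move=> at_; rewrite itv_int_cst// mulrC.
split => //.
- apply: (eq_primitive b0 _ _
    (switch_primitive (T := b) (g := cst e.1) a0 (trajectory_fst tr) _ _)) => //.
  + by move=> t _; rewrite /switch; case: ifP.
  + move=> t _; have [ta|at_] := ltP t a; first by rewrite !switch_lt.
    by rewrite !switch_ge//= cst_int.
- apply: (eq_primitive b0 _ _
    (switch_primitive (T := b) (g := cst e.2) a0 (trajectory_snd tr) _ _)) => //.
  + by move=> t _; rewrite /switch; case: ifP.
  + move=> t _; have [ta|at_] := ltP t a; first by rewrite !switch_lt.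
    by rewrite !switch_ge//= cst_int.
- move=> t /andP[t0 tb]; have [ta|at_] := ltP t a; last by rewrite switch_ge// e1.
  by rewrite switch_lt// (trajectory_speed tr)// t0 ltW.
- have hb t : a <= t <= b -> `|h t| <= A + B.
    by move=> tab; rewrite hE//; exact: fR_bound.
  apply: (eq_primitive b0 _ _ (switch_primitive a0 (trajectory_R tr) mh hb)) => //.
  move=> t /andP[t0 tb]; have [ta|at_] := ltP t a; first by rewrite !switch_lt.
  by rewrite !switch_ge// hE// at_.
- by rewrite switch_le// (trajectory_s0 tr).
- by rewrite switch_le// (trajectory_R0 tr).
- move=> t /andP[t0 tb]; have [ta|at_] := ltP t a.
    by rewrite switch_lt// (trajectory_R_ge0 tr)// t0 ltW.
  by rewrite switch_ge// R_ge0// at_.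
Qed.

(** Outside the disk the drift is positive, and by the speed limit it was so for a while before
    [tau]; the uncertainty would have been negative then. *)
Lemma drained_inside T u s Rt tau : trajectory T u s Rt -> 0 <= tau <= T ->
  Rt tau = 0 -> sqd (s tau) x <= eqr.
Proof.
move=> tr /andP[tau0 tauT] Rtau; rewrite leNgt; apply/negP => out.
have eqr0 := equilibrium_gt0 hr hA hAB.
have tau_gt0 : 0 < tau.
  rewrite lt_def tau0 andbT; apply/eqP => tauE.
  by move: hRc; rewrite -(trajectory_R0 tr) -{2}tauE Rtau ltxx.
have [d d0 dE] : exists2 d, 0 <= d & sqd (s tau) x = d ^+ 2.
  by exists (dist2 (s tau) x); rewrite ?dist2_ge0 ?dist2_sqr.
have [l l0 lE] : exists2 l, 0 <= l & eqr = l ^+ 2.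
  by exists (Num.sqrt eqr); rewrite ?sqrtr_ge0 ?sqr_sqrtr ?ltW.
have ld : l < d by rewrite -ltr_sqr ?nnegrE// -dE -lE.
(* Less than [(d - l) / 2] before reaching radius [d], a unit-speed agent cannot have been inside
   the midway radius [m]. *)
pose w := Num.min tau ((d - l) / 2).
have w0 : 0 < w by rewrite lt_min tau_gt0 divr_gt0// subr_gt0.
have wtau : w <= tau by rewrite ge_min lexx.
have wd : w <= (d - l) / 2 by rewrite ge_min lexx orbT.
pose m := (d + l) / 2.
have m_out : eqr < m ^+ 2.
  by rewrite lE ltr_sqr ?nnegrE /m; lra.
have far t : tau - w <= t <= tau -> rate (m ^+ 2) <= fR (Rt t) (s t).
  move=> /andP[wt ttau].
  have mt : m ^+ 2 <= sqd (s t) x.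
    rewrite leNgt -dist2_sqr; apply/negP => near.
    have near' : dist2 (s t) x < m.
      by rewrite -ltr_sqr ?nnegrE ?dist2_ge0// /m; lra.
    have t0 : 0 <= t by lra.
    have := sqd_triangle (dist2_ge0 (s t) x) (_ : 0 <= tau - t)
      (_ : sqd (s t) x <= _) (trajectory_speed_limit tr t0 ttau tauT).
    rewrite subr_ge0 dist2_sqr => /(_ ttau (lexx _)).
    rewrite dE ler_sqr ?nnegrE//; last first.
      by rewrite addr_ge0 ?dist2_ge0// subr_ge0.
    by rewrite /m in near'; lra.
  rewrite fRE (_ : (rate _ < 0) = false) ?andbF ?le_rate//.
  by apply/negbTE; rewrite -leNgt ltW// rate_gt0// (lt_le_trans m_out).
have := primitive_ge (trajectory_R tr) (_ : 0 <= tau - w) (_ : tau - w <= tau) tauT far.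
rewrite subr_ge0 gerBl => /(_ wtau (ltW w0)).
have : 0 < rate (m ^+ 2) * w by rewrite mulr_gt0// rate_gt0.
have : 0 <= Rt (tau - w).
  by rewrite (trajectory_R_ge0 tr)// subr_ge0 wtau/= (le_trans _ tauT)// gerBl ltW.
by rewrite Rtau (_ : tau - (tau - w) = w); [lra|ring].
Qed.

End Trajectories.

(** * Feasible competitors, built by continuing a trajectory *)

Section Optimal.
Context {R : realType} (x : R * R) (r A B Rc : R) (sphi spsi : R * R).
Hypotheses (hr : 0 < r) (hA : 0 < A) (hAB : A < B) (hRc : 0 < Rc).
Hypothesis hpsi : sqd spsi x = r ^+ 2.
Notation mu := (@lebesgue_measure R).
Notation fR := (fR A B r x).
Notation rate := (rate A B r).
Notation eqr := (equilibrium A B r).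
Notation trajectory := (trajectory x r A B Rc sphi).
Implicit Types (a b t T : R) (u s : R -> R * R) (Rt h : R -> R).

Lemma inside_dist2_gt0 p : sqd p x <= eqr -> 0 < dist2 spsi p.
Proof.
move=> pin; apply: (@dist2_gt0_of_sqd _ _ _ x).
by rewrite hpsi (le_lt_trans pin)// equilibrium_lt.
Qed.

(** Along the straight run the drift is the positive part of [g]: the uncertainty stays zero inside
    the disk and can grow only after the exit. *)
Lemma drained_extend a u s Rt : trajectory a u s Rt -> Rt a = 0 ->
  exists u' s' Rt',
    feasible A B r x sphi spsi Rc (a + dist2 spsi (s a)) u' s' Rt'.
Proof.
move=> tr Ra; have a0 := trajectory_ge0 tr.
have sa_in : sqd (s a) x <= eqr.
  by apply: drained_inside tr _ Ra => //; rewrite a0 lexx.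
have D0 := inside_dist2_gt0 sa_in.
set D := dist2 _ _ in D0 *; set e := direction (s a) spsi.
pose g t := rate (sqd (line (s a) e (t - a)) x).
pose h t := Num.max 0 (g t).
have ab : a <= a + D by rewrite lerDl ltW.
have ch : continuous h.
  move=> t; apply: (@continuous_max _ _ (fun=> 0) g); first exact: cvg_cst.
  exact: continuous_rate_line.
have mh : measurable_fun [set` `[a, a + D]] h.
  by apply: measurable_funTS; exact: continuous_measurable_fun.
have hE t : a <= t <= a + D ->
    h t = fR (Rt a + itv_int a t h) (line (s a) e (t - a)).
  move=> /andP[at_ tb]; rewrite fRE -/(g t) Ra add0r.
  (* If [g t < 0], the run is in the disk at time [t] and, by convexity, at all times since [a]; so
     [h] has zero integral and [fR] is clamped. *)
  have [gt0|gt0] := ltP (g t) 0; last by rewrite andbF /h max_r.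
  rewrite (_ : itv_int a t h = 0) ?eqxx/= /h ?max_l ?(ltW gt0)//.
  transitivity (itv_int a t (cst 0)); last by rewrite itv_int_cst// mul0r.
  apply: itv_int_eq => w /andP[aw wt]; rewrite /h max_l// leNgt rate_gt0//.
  rewrite -leNgt; apply: (@sqd_line_le _ _ _ _ (t - a)) => //.
    by apply/andP; split; lra.
  by apply: ltW; rewrite -(rate_lt0 hr hA hAB).
have R_ge0 t : a <= t <= a + D -> 0 <= Rt a + itv_int a t h.
  move=> _; rewrite Ra add0r; apply: Rintegral_ge0 => w _.
  by rewrite /h le_max lexx.
have := trajectory_extend hr hA hAB tr ab (direction_unit D0) mh hE R_ge0.
move=> tr'; exists (switch a u (cst e)), (switch a s (fun t => line (s a) e (t - a))),
  (switch a Rt (fun t => Rt a + itv_int a t h)).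
apply/feasibleP => //; split => //.
  by rewrite switch_ge// addrC addKr line_direction.
by exists a; rewrite ?a0 ?ab// switch_ge// itv_int_xx addr0.
Qed.

(** The drift is negative along the segment to [m], and on its second half at most
    [rate ((eqr + sqd m x) / 2)]. So the remainder [Rt b] is used up by the time [m] is reached, and
    cutting straight to [spsi] from there is no longer than passing through [m]. *)
Lemma drained_extend_via b u s Rt (m : R * R) :
  trajectory b u s Rt -> 0 < Rt b -> sqd (s b) x < eqr -> sqd m x < eqr ->
  0 < dist2 m (s b) ->
  Rt b <= - rate ((eqr + sqd m x) / 2) * (dist2 m (s b) / 2) ->
  exists T' u' s' Rt', feasible A B r x sphi spsi Rc T' u' s' Rt' /\
    T' <= b + dist2 m (s b) + dist2 spsi m.
Proof.
move=> tr Rb0 b_in m_in L0 Rb; have b0 := trajectory_ge0 tr.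
have e1 := direction_unit L0; have mE := line_direction L0.
set L := dist2 _ _ in L0 Rb mE *; set e := direction _ _ in e1 mE.
set c := - rate _ in Rb.
pose g t := rate (sqd (line (s b) e (t - b)) x).
have cg : continuous g by exact: continuous_rate_line.
have mg a t : measurable_fun [set` `[a, t]] g.
  by apply: measurable_funTS; exact: continuous_measurable_fun.
have ig a t : mu.-integrable [set` `[a, t]] (EFin \o g).
  apply: (@bounded_itv_integrable _ _ _ _ (A + B)) => // w _.
  by rewrite rate_bound// sqd_ge0.
pose y t := Rt b + itv_int b t g.
pose M := Num.max (sqd (s b) x) (sqd m x).
have M_in : rate M < 0 by rewrite rate_lt0// gt_max b_in.
have gM t : b <= t <= b + L -> g t <= rate M.
  move=> /andP[bt tL]; apply: le_rate => //.
  apply: (@sqd_line_le _ _ _ _ L); rewrite ?mE ?le_max ?lexx ?orbT//.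
  by apply/andP; split; lra.
(* From halfway on, [m] has weight at least 1/2, so the squared distance is at most the mean of
   [eqr] and [sqd m x]. *)
have g_half t : b + L / 2 <= t <= b + L -> g t <= - c.
  move=> /andP[bt tL]; rewrite opprK; apply: le_rate => //.
  have k_half : 1 / 2 <= (t - b) / L by rewrite ler_pdivlMr//; lra.
  have k1 : (t - b) / L <= 1 by rewrite ler_pdivrMr//; lra.
  rewrite (line_convex _ _ _ (lt0r_neq0 L0)) mE sqd_convex.
  move: ((t - b) / L) k_half k1 => k k_half k1.
  have i1 : 0 <= (1 - k) * (eqr - sqd (s b) x) by rewrite mulr_ge0 ?subr_ge0// ltW.
  have i2 : 0 <= (k - 1 / 2) * (eqr - sqd m x) by rewrite mulr_ge0 ?subr_ge0// ltW.
  have i3 : 0 <= k * (1 - k) * sqd (s b) m.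
    by apply: mulr_ge0 (sqd_ge0 _ _); rewrite mulr_ge0 ?subr_ge0//; lra.
  by lra.
have y_end : y (b + L) <= 0.
  have L2 : 0 <= L / 2 by rewrite divr_ge0// ltW.
  have h1 : b <= b + L / 2 by rewrite lerDl.
  have h2 : b + L / 2 <= b + L by lra.
  rewrite /y (itv_int_split h1 h2)//.
  have i1 : itv_int b (b + L / 2) g <= rate M * (b + L / 2 - b).
    by apply: itv_int_le_cst => // t /andP[bt tL]; apply: gM; rewrite bt (le_trans tL).
  have i2 := itv_int_le_cst h2 (ig _ _) g_half.
  have : rate M * (L / 2) <= 0 by rewrite mulr_le0_ge0// ltW.
  by move: i1 i2 Rb; lra.
(* [y] is the uncertainty as long as no clamping occurs; it starts positive and is nonpositive at
   [m]. *)
have [|||tz] := @IVT R y b (b + L) 0.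
- by rewrite lerDl ltW.
- have pc := parameterized_integral_continuous (_ : b <= b + L) (ig b (b + L)).
  move=> t; apply: cvgD; first exact: cvg_cst.
  by apply: pc; rewrite lerDl ltW.
- by rewrite ge_min y_end orbT/= le_max /y itv_int_xx addr0 (ltW Rb0).
rewrite in_itv/= => /andP[btz tzL] ytz.
(* The strictly negative drift makes [tz] the first zero, so no clamping occurs before it. *)
have y_gt0 t : b <= t -> t < tz -> 0 < y t.
  move=> bt ttz; rewrite -ytz /y (itv_int_split bt (ltW ttz))// addrA gtrDl.
  have : itv_int t tz g <= rate M * (tz - t).
    apply: itv_int_le_cst => //; first exact: ltW.
    by move=> w /andP[tw wtz]; apply: gM; rewrite (le_trans bt)//= (le_trans wtz).
  move=> /le_lt_trans; apply.
  by rewrite nmulr_rlt0// subr_gt0.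
(* At the hitting time [tz] itself [fR] is 0 although [g tz < 0], so [g] has to
   be changed at that single point. *)
pose h := switch tz g (cst 0).
have mh : measurable_fun [set` `[b, tz]] h by exact: switch_measurable.
have hI t : b <= t <= tz -> itv_int b t h = itv_int b t g.
  move=> /andP[bt ttz]; apply: eq_itv_int_oo => //.
    by apply: measurable_funS mh => //; apply: subset_itvScc; rewrite bnd_simp.
  by move=> w /andP[_ wt]; rewrite /h switch_lt// (lt_le_trans wt).
have hE t : b <= t <= tz -> h t = fR (Rt b + itv_int b t h) (line (s b) e (t - b)).
  move=> btz'; rewrite hI// fRE -/(g t) -/(y t); have /andP[bt] := btz'.
  rewrite le_eqVlt => /predU1P[tE|ttz].
    rewrite tE ytz eqxx /h switch_ge//= (le_lt_trans _ M_in)// gM//.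
    by rewrite btz.
  by rewrite /h switch_lt// gt_eqF// y_gt0.
have R_ge0 t : b <= t <= tz -> 0 <= Rt b + itv_int b t h.
  move=> btz'; rewrite hI// -/(y t); have /andP[bt] := btz'.
  by rewrite le_eqVlt => /predU1P[->|ttz]; [rewrite ytz|rewrite ltW// y_gt0].
have tr' := trajectory_extend hr hA hAB tr btz e1 mh hE R_ge0.
have [|u' [s' [R' f']]] := drained_extend tr'.
  by rewrite switch_ge// hI ?btz ?lexx.
exists (tz + dist2 spsi (line (s b) e (tz - b))), u', s', R'.
rewrite switch_ge// in f'; split => //.
(* At time [tz] the agent is at distance [L - (tz - b)] from [m]; the triangle inequality through
   [m] bounds the final run. *)
have Ltz : 0 <= L - (tz - b) by lra.
have := sqd_triangle Ltz (dist2_ge0 spsi m)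
  (_ : sqd m (line (s b) e (tz - b)) <= _) (_ : sqd spsi m <= _).
rewrite -{1}mE line_sqd// dist2_sqr => /(_ (lexx _) (lexx _)).
have sum0 := addr_ge0 Ltz (dist2_ge0 spsi m).
rewrite -dist2_sqr ler_sqr ?nnegrE ?dist2_ge0//.
by lra.
Qed.

(** * The shape of an optimal trajectory *)

Section OptimalTrajectory.
Variables (T : R) (u s : R -> R * R) (Rt : R -> R).
Hypothesis opt : optimal A B r x sphi spsi Rc T u s Rt.

Lemma optimal_trajectory : trajectory T u s Rt.
Proof. by case: opt => /feasibleP[]. Qed.
Let tr := optimal_trajectory.

Lemma optimal_end : s T = spsi.
Proof. by case: opt => /feasibleP[]. Qed.

Lemma optimal_drained_inside a : 0 <= a <= T -> Rt a = 0 -> sqd (s a) x <= eqr.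
Proof. by move=> aT; exact: drained_inside tr aT. Qed.

(** The straight run is feasible, so the remaining time is at most the distance to go; the speed
    limit gives the converse. *)
Lemma optimal_time_to_go a : 0 <= a <= T -> Rt a = 0 ->
  T = a + dist2 spsi (s a).
Proof.
move=> /andP[a0 aT] Ra; apply/eqP; rewrite eq_le; apply/andP; split.
  have [u' [s' [R' f']]] := drained_extend (trajectory_sub a0 aT tr) Ra.
  by case: opt => _ /(_ _ _ _ _ f').
have := trajectory_speed_limit tr a0 aT (lexx T).
rewrite optimal_end -dist2_sqr ler_sqr ?nnegrE ?dist2_ge0 ?subr_ge0//.
by rewrite lerBrDl.
Qed.

(** By [optimal_time_to_go], the speed limits from [a] to [t] and from [t] to [T] leave no slack in
    the triangle inequality. *)
Lemma optimal_straight a t : 0 <= a -> Rt a = 0 -> a <= t <= T ->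
  s t = line (s a) (direction (s a) spsi) (t - a).
Proof.
move=> a0 Ra /andP[at_ tT]; have aT := le_trans at_ tT.
have aT' : 0 <= a <= T by rewrite a0.
have D0 := inside_dist2_gt0 (optimal_drained_inside aT' Ra).
have TE := optimal_time_to_go aT' Ra.
have t0 := le_trans a0 at_.
have := sqd_triangle_eq (_ : 0 <= t - a) (_ : 0 <= T - t)
  (trajectory_speed_limit tr a0 at_ tT) (trajectory_speed_limit tr t0 tT (lexx T)).
rewrite !subr_ge0 optimal_end => /(_ at_ tT).
rewrite (_ : t - a + (T - t) = dist2 spsi (s a)); last by rewrite [in LHS]TE; ring.
rewrite dist2_sqr lexx => /(_ erefl) [e1 e2].
have Dn : dist2 spsi (s a) != 0 by rewrite gt_eqF.
rewrite /line /direction [LHS]surjective_pairing; congr pair.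
  apply: (mulfI Dn); rewrite e1 [in LHS]TE /=; field.
  by rewrite Dn.
apply: (mulfI Dn); rewrite e2 [in LHS]TE /=; field.
by rewrite Dn.
Qed.

(** The component of [u] along the run is at most 1 and has integral [T - a], so it is 1 almost
    everywhere. The trajectory does not determine [u] on null sets, hence the [ae]. *)
Lemma optimal_control a : 0 <= a <= T -> Rt a = 0 ->
  {ae mu, forall t, t \in `[a, T] -> u t = direction (s a) spsi}.
Proof.
move=> /andP[a0 aT] Ra; have aT' : 0 <= a <= T by rewrite a0.
have D0 := inside_dist2_gt0 (optimal_drained_inside aT' Ra).
have e1 := direction_unit D0; set e := direction _ _ in e1 *.
have pl := primitive_lin e.1 e.2 (trajectory_fst tr) (trajectory_snd tr).
have ule t : a <= t <= T -> e.1 * (u t).1 + e.2 * (u t).2 <= 1.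
  move=> /andP[at_ tT]; rewrite -[leRHS]mulr1; apply: dot_le; rewrite ?e1 ?expr1n//.
  by rewrite (trajectory_speed tr)// (le_trans a0).
have incr : e.1 * (s T).1 + e.2 * (s T).2 - (e.1 * (s a).1 + e.2 * (s a).2) =
    1 * (T - a).
  have := @optimal_straight a T a0 Ra; rewrite aT lexx -/e => /(_ erefl) ->.
  by rewrite mul1r -[RHS]mulr1 -e1 /=; ring.
have := primitive_ae_max pl a0 aT (lexx T) ule incr.
apply: filterS; first exact: (ae_filter_ringOfSetsType mu).
move=> t + taT => /(_ taT) eu; move: taT; rewrite in_itv/= => /andP[at_ tT].
have := trajectory_speed tr (_ : 0 <= t <= T); rewrite tT (le_trans a0)//.
move=> /(_ erefl) u1.
(* The squared norm of [u t - e] expands to at most 1 - 2 + 1. *)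
have : ((u t).1 - e.1) ^+ 2 + ((u t).2 - e.2) ^+ 2 <= 0 by nra.
rewrite le_eqVlt ltNge addr_ge0 ?sqr_ge0// orbF paddr_eq0 ?sqr_ge0// !sqrf_eq0.
rewrite !subr_eq0 => /andP[/eqP h1 /eqP h2].
by rewrite [LHS]surjective_pairing h1 h2.
Qed.

(** The straight run after a drained time starts in the disk and ends at radius [r], beyond it, so
    it meets the circle. *)
Lemma optimal_exit_exists :
  exists t0, [/\ 0 <= t0 <= T, sqd (s t0) x = eqr & Rt t0 = 0].
Proof.
have [_ _ [tau tauT Rtau]] := (feasibleP x Rc sphi hr hA hAB spsi T u s Rt).1 opt.1.
have /andP[tau0 tau_le] := tauT.
have sin := optimal_drained_inside tauT Rtau.
have sE := optimal_straight tau0 Rtau; set e := direction _ _ in sE.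
have [||c] := @IVT R (fun t => sqd (line (s tau) e (t - tau)) x) tau T eqr tau_le.
- by apply: continuous_subspaceT => t; exact: continuous_sqd_line.
- rewrite -!sE ?lexx ?tau_le// optimal_end hpsi.
  by rewrite ge_min le_max sin (ltW (equilibrium_lt hr hA hAB)) orbT.
rewrite in_itv/= => /andP[tc cT]; rewrite -sE ?tc// => sc.
have c0 := le_trans tau0 tc.
exists c; split => //; first by rewrite c0.
(* By convexity the run up to [c] lies in the disk, where the drift is nonpositive, so the
   uncertainty cannot rise from zero. *)
apply/eqP; rewrite eq_le (trajectory_R_ge0 tr) ?c0// andbT.
have := primitive_le (trajectory_R tr) tau0 tc cT (k := 0).
rewrite mul0r Rtau subr0; apply => t /andP[taut tc'].
have : rate (sqd (s t) x) <= 0.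
  rewrite leNgt rate_gt0// -leNgt sE ?taut ?(le_trans tc')//.
  apply: (@sqd_line_le _ _ _ _ (c - tau)) => //.
    by apply/andP; split; lra.
  by rewrite -sE ?tc// sc.
by rewrite fRE; case: ifP.
Qed.

(** Otherwise the straight run from [s z] to [s w] has both ends in the closed disk, and its
    intermediate point [s a] is strictly inside. *)
Lemma not_drained_before z a w : 0 <= z -> z < a -> a < w -> w <= T ->
  sqd (s a) x = eqr -> sqd (s w) x <= eqr -> Rt z != 0.
Proof.
move=> z0 za aw wT sa sw; apply/eqP => Rz.
have zw := lt_trans za aw.
have zT : 0 <= z <= T by rewrite z0 ltW// (lt_le_trans zw).
have zin := optimal_drained_inside zT Rz.
have e1 := direction_unit (inside_dist2_gt0 zin).
have sE := optimal_straight z0 Rz.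
suff : sqd (s a) x < eqr by rewrite sa ltxx.
rewrite sE ?(ltW za) ?(le_trans (ltW aw))//.
apply: (@sqd_line_lt _ _ _ _ (w - z)) => //.
  by apply/andP; split; lra.
by rewrite -sE// (ltW zw).
Qed.

(** If the agent stayed on or outside the circle just before [a], the drift would be nonnegative
    there and the uncertainty already zero before [a]. *)
Lemma exit_approached_from_inside a k : 0 < a -> a <= T -> 0 < k ->
  (forall z, 0 <= z < a -> Rt z != 0) -> Rt a = 0 -> sqd (s a) x = eqr ->
  exists2 b, [/\ 0 <= b, b < a & a - b <= k] & sqd (s b) x < eqr.
Proof.
move=> a0 aT k0 nz Ra sa; apply: contrapT => no.
pose w := Num.min a k.
have w0 : 0 < w by rewrite lt_min a0.
have wa : w <= a by rewrite ge_min lexx.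
have wk : w <= k by rewrite ge_min lexx orbT.
have aw0 : 0 <= a - w by rewrite subr_ge0.
have far t : a - w <= t <= a -> 0 <= fR (Rt t) (s t).
  move=> /andP[wt ta].
  have : eqr <= sqd (s t) x.
    move: ta; rewrite le_eqVlt => /predU1P[->|ta]; first by rewrite sa.
    rewrite leNgt; apply/negP => tin; apply: no; exists t => //; split; lra.
  rewrite leNgt -(rate_lt0 hr hA hAB) fRE => /negbTE h.
  by rewrite h andbF leNgt h.
have := primitive_ge (trajectory_R tr) aw0 (_ : a - w <= a) aT far.
rewrite gerBl mul0r Ra sub0r oppr_ge0 => /(_ (ltW w0)) Rle.
have : Rt (a - w) != 0 by apply: nz; rewrite aw0 gtrBl.
rewrite eq_le Rle (trajectory_R_ge0 tr) ?aw0//=.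
by rewrite (le_trans _ aT)// gerBl ltW.
Qed.

(** The competitor leaves at a time [b] shortly before [a] and heads for the midpoint [m] of the
    chord; optimality makes the triangle [s b], [s a], [m] degenerate. *)
Lemma optimal_exit_unique a w : 0 <= a -> a < w -> w <= T ->
  Rt a = 0 -> sqd (s a) x = eqr -> sqd (s w) x <= eqr -> False.
Proof.
move=> a0 aw wT Ra sa sw.
have aT : 0 <= a <= T by rewrite a0 ltW// (lt_le_trans aw).
have [_ aT'] := andP aT.
have a_gt0 : 0 < a.
  rewrite lt_def a0 andbT; apply/eqP => aE.
  by move: hRc; rewrite -(trajectory_R0 tr) -{2}aE Ra ltxx.
have nz z : 0 <= z < a -> Rt z != 0.
  by move=> /andP[z0 za]; exact: (not_drained_before z0 za aw).
have e1 := direction_unit (inside_dist2_gt0 (optimal_drained_inside aT Ra)).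
have sE := optimal_straight a0 Ra; set e := direction _ _ in e1 sE.
(* Half the duration of the chord, so that [m] below is its midpoint. *)
pose h := (w - a) / 2.
have h0 : 0 < h by rewrite divr_gt0// subr_gt0.
have hT : a + h <= T by rewrite /h; lra.
have mE : s (a + h) = line (s a) e h.
  by rewrite sE ?hT ?lerDl ?(ltW h0)// addrC addKr.
set m := s (a + h) in mE.
have m_in : sqd m x < eqr.
  rewrite mE; apply: (@sqd_line_lt _ _ _ _ (w - a)) => //.
  - by apply/andP; split; rewrite /h; lra.
  - by rewrite sa.
  - by rewrite -sE// (ltW aw).
pose q := (eqr + sqd m x) / 2.
have q_in : q < eqr by rewrite /q; lra.
pose c := - rate q.
have c0 : 0 < c by rewrite oppr_gt0 rate_lt0.
have AB0 : 0 < A + B by rewrite addr_gt0// (lt_trans hA hAB).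
(* The first bound keeps [s b] at distance at least [h / 2] from [m]; the second gives
   [Rt b <= (A + B) * k <= c * h / 4], which the second half of the way to [m] can drain. *)
pose k := Num.min (h / 2) (c * h / 4 / (A + B)).
have k0 : 0 < k.
  rewrite lt_min; apply/andP; split; first exact: divr_gt0.
  by apply: divr_gt0 => //; apply: divr_gt0 => //; exact: mulr_gt0.
have [b [b0 ba bk] b_in] := exit_approached_from_inside a_gt0 aT' k0 nz Ra sa.
have kh : k <= h / 2 by rewrite ge_min lexx.
have kc : (A + B) * k <= c * h / 4.
  by rewrite mulrC -ler_pdivlMr// ge_min lexx orbT.
have bT : b <= T := le_trans (ltW ba) aT'.
have Rb : Rt b <= (A + B) * (a - b).
  have lo t : b <= t <= a -> - (A + B) <= fR (Rt t) (s t).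
    move=> _; have := fR_bound hr hA hAB x (Rt t) (s t).
    by rewrite ler_norml => /andP[].
  by have := primitive_ge (trajectory_R tr) b0 (ltW ba) aT' lo; rewrite Ra; lra.
have L_ge : h / 2 <= dist2 m (s b).
  have := sqd_triangle (dist2_ge0 m (s b)) (_ : 0 <= a - b)
    (_ : sqd (s b) m <= _) (trajectory_speed_limit tr b0 (ltW ba) aT').
  rewrite sqdC dist2_sqr subr_ge0 => /(_ (ltW ba) (lexx _)).
  rewrite sqdC mE sqd_line//.
  have ab : 0 <= a - b by rewrite subr_ge0 ltW.
  have sum0 := addr_ge0 (dist2_ge0 m (s b)) ab.
  rewrite -mE ler_sqr ?nnegrE ?(ltW h0)//.
  by move: bk kh; lra.
have Rb0 : 0 < Rt b by rewrite lt_def nz ?b0//= (trajectory_R_ge0 tr) ?b0.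
have L0 : 0 < dist2 m (s b) by rewrite (lt_le_trans _ L_ge)// divr_gt0.
have Rbc : Rt b <= c * (dist2 m (s b) / 2).
  have h1 : (A + B) * (a - b) <= (A + B) * k by rewrite ler_pM2l.
  have h2 : c * (h / 2) <= c * dist2 m (s b) by rewrite ler_pM2l.
  by lra.
have [T' [u' [s' [R' [f' T'_le]]]]] :=
  drained_extend_via (trajectory_sub b0 bT tr) Rb0 b_in m_in L0 Rbc.
have TT' : T <= T' by case: opt => _ /(_ _ _ _ _ f').
have spsi_m : dist2 spsi m <= T - (a + h).
  have ah0 : 0 <= a + h by rewrite addr_ge0// ltW.
  have := trajectory_speed_limit tr ah0 hT (lexx T).
  by rewrite optimal_end -dist2_sqr ler_sqr ?nnegrE ?dist2_ge0 ?subr_ge0.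
(* Chains [T <= T' <= b + dist2 m (s b) + dist2 spsi m] with the speed limit after [a + h]: the
   direct way to [m] is no shorter than the one through [s a]. *)
have aL : a - b + h <= dist2 m (s b) by lra.
have ab0 : 0 < a - b by rewrite subr_gt0.
have [||q1 q2] := sqd_triangle_eq (ltW ab0) (ltW h0)
  (trajectory_speed_limit tr b0 (ltW ba) aT') (_ : sqd m (s a) <= _) _.
- by rewrite mE sqd_line.
- by rewrite -dist2_sqr ler_sqr ?nnegrE ?dist2_ge0// addr_ge0// ltW.
(* [s b] and [m] are strictly inside the disk, yet [s a], between them, is on its boundary. *)
by have := sqd_between_lt ab0 h0 q1 q2 b_in m_in; rewrite sa ltxx.
Qed.

End OptimalTrajectory.
End Optimal.

Theorem theorem1 (R : realType) (x : R * R) (r A B Rc : R) (sphi spsi : R * R)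
  (hr : 0 < r) (hA : 0 < A) (hAB : A < B) (hRc : 0 < Rc)
  (hphi : dist2 sphi x = r) (hpsi : dist2 spsi x = r)
  (Ts : R) (us : R -> R * R) (ss : R -> R * R) (Rs : R -> R) :
  optimal A B r x sphi spsi Rc Ts us ss Rs ->
  let delta := Num.sqrt (r ^+ 2 * (B - A) / B) in
  (exists! t0, t0 \in `[0, Ts] /\ dist2 (ss t0) x = delta /\ Rs t0 = 0) /\
  (forall t0, t0 \in `[0, Ts] -> dist2 (ss t0) x = delta -> Rs t0 = 0 ->
     {ae (@lebesgue_measure R), forall t, t \in `[t0, Ts] ->
        us t = ((spsi.1 - (ss t0).1) / dist2 spsi (ss t0),
                (spsi.2 - (ss t0).2) / dist2 spsi (ss t0))}).
Proof.
move=> opt delta.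
have hpsi' : sqd spsi x = r ^+ 2 by rewrite -hpsi dist2_sqr.
have eqr0 := equilibrium_gt0 hr hA hAB.
have onE p : dist2 p x = delta <-> sqd p x = equilibrium A B r.
  split=> [pd|pe]; last by rewrite /dist2 -/(sqd p x) pe.
  by rewrite -dist2_sqr pd sqr_sqrtr// ltW.
(* The later point on the circle would end a chord that the straight run begins at the earlier
   one. *)
have no2 a b : a \in `[0, Ts] -> dist2 (ss a) x = delta -> Rs a = 0 ->
    b \in `[0, Ts] -> dist2 (ss b) x = delta -> a < b -> False.
  rewrite !in_itv/= => /andP[a0 _] /onE sa Ra /andP[_ bT] /onE sb ab.
  by apply: (optimal_exit_unique hr hA hAB hRc hpsi' opt a0 ab bT Ra sa); rewrite sb.
split; last first.
  move=> t0; rewrite in_itv/= => t0T _ Rt0.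
  exact: (optimal_control hr hA hAB hRc hpsi' opt t0T Rt0).
have [t0 [t0T st0 Rt0]] := optimal_exit_exists hr hA hAB hRc hpsi' opt.
have t0I : t0 \in `[0, Ts] by rewrite in_itv.
have dt0 : dist2 (ss t0) x = delta by apply/onE.
exists t0; split=> // t1 [t1I [dt1 Rt1]].
case: (ltgtP t0 t1) => // [lt01|lt10].
  by case: (no2 t0 t1).
by case: (no2 t1 t0).
Qed.
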